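(* The category of inverse semigroups and prehomomorphisms is isomorphic to the category of inductive groupoids and ordered functors. Likewise, the category of inverse semigroups and (semigroup) homomorphisms is isomorphic to the category of inductive groupoids and inductive functors.
   Context: A category is regarded as a set of arrows with a partial product; $C_o$ is its set of identities, $\mathbf{d}(x)$ and $\mathbf{r}(x)$ are the domain and range identities of $x$, and $xy$ is defined (written $\exists xy$) iff $\mathbf{d}(x)=\mathbf{r}(y)$. A groupoid is a category in which every arrow is invertible. An ordered groupoid is a groupoid $G$ with a partial order $\leq$ on the set $G$ such that: (i) $x\leq y$ implies $x^{-1}\leq y^{-1}$; (ii) if $x\leq y$, $u\leq v$, $\exists xu$ and $\exists yv$ then $xu\leq yv$; (iii) if $e$ is an identity with $e\leq\mathbf{d}(x)$ then there is a unique element $(x\,|\,e)$ with $(x\,|\,e)\leq x$ and $\mathbf{d}(x\,|\,e)=e$; (iv) if $e$ is an identity with $e\leq\mathbf{r}(x)$ then there is a unique element $(e\,|\,x)$ with $(e\,|\,x)\leq x$ and $\mathbf{r}(e\,|\,x)=e$. It is inductive if its partially ordered set of identities is a meet-semilattice. An ordered functor between ordered groupoids is an order-preserving functor; an ordered functor between inductive groupoids is inductive if it preserves the meet operation on identities. On an inverse semigroup the natural partial order is $s\leq t$ iff $s=te$ for some idempotent $e$. A prehomomorphism between inverse semigroups is a function $\theta:S\to T$ with $\theta(st)\leq\theta(s)\theta(t)$ for all $s,t\in S$. *)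

(* Defs.v *)
From Stdlib Require Import Relation_Definitions Setoid ProofIrrelevance.

Set Implicit Arguments.

Record Cat : Type := {
  obj : Type;
  hom : obj -> obj -> Type;
  idn : forall A, hom A A;
  cmp : forall A B C, hom B C -> hom A B -> hom A C;
  cmp_idl : forall A B (f : hom A B), cmp (idn B) f = f;
  cmp_idr : forall A B (f : hom A B), cmp f (idn A) = f;
  cmp_assoc : forall A B C D (h : hom C D) (g : hom B C) (f : hom A B),
    cmp h (cmp g f) = cmp (cmp h g) f }.

Arguments hom {c} _ _.
Arguments idn {c} _.
Arguments cmp {c A B C} _ _.

Record Functor (C D : Cat) : Type := {
  fobj :> obj C -> obj D;
  fmap : forall {A B : obj C}, hom A B -> hom (fobj A) (fobj B);
  fmap_id : forall A, fmap (idn A) = idn (fobj A);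
  fmap_cmp : forall A B E (g : hom B E) (f : hom A B),
    fmap (cmp g f) = cmp (fmap g) (fmap f) }.

Arguments fmap {C D} _ {A B} _.

Definition functor_id (C : Cat) : Functor C C :=
  {| fobj := fun A => A;
     fmap := fun A B f => f;
     fmap_id := fun A => eq_refl;
     fmap_cmp := fun A B E g f => eq_refl |}.

Definition functor_comp (C D E : Cat) (G : Functor D E) (F : Functor C D) :
  Functor C E.
Proof.
refine {| fobj := fun A => G (F A);
          fmap := fun A B f => fmap G (fmap F f) |}.
- intros A. rewrite fmap_id. apply fmap_id.
- intros A B X g f. rewrite fmap_cmp. apply fmap_cmp.
Defined.

(* Isomorphism in the strict sense (not equivalence): the two composites are
   equal to the identity functors. *)
Definition isomorphic_categories (C D : Cat) : Prop :=
  exists (F : Functor C D) (G : Functor D C),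
    functor_comp G F = functor_id C /\ functor_comp F G = functor_id D.

Definition concrete_cat (O : Type) (car : O -> Type)
    (P : forall A B : O, (car A -> car B) -> Prop)
    (P_id : forall A, P A A (fun x => x))
    (P_cmp : forall A B C (g : car B -> car C) (f : car A -> car B),
       P B C g -> P A B f -> P A C (fun x => g (f x))) : Cat.
Proof.
refine {| obj := O;
          hom := fun A B => {f : car A -> car B | P A B f};
          idn := fun A => exist _ (fun x => x) (P_id A);
          cmp := fun A B C g f =>
            exist _ (fun x => proj1_sig g (proj1_sig f x))
              (P_cmp _ _ _ _ _ (proj2_sig g) (proj2_sig f)) |}.
- intros A B [f Hf]. apply subset_eq_compat. reflexivity.
- intros A B [f Hf]. apply subset_eq_compat. reflexivity.
- intros A B C D h g f. apply subset_eq_compat. reflexivity.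
Defined.

(* The carrier may be empty, and so may that of an inductive groupoid. *)
Record InverseSemigroup : Type := {
  scar :> Type;
  sop : scar -> scar -> scar;
  sop_assoc : forall x y z, sop x (sop y z) = sop (sop x y) z;
  sop_inverse : forall s, exists! t,
    sop (sop s t) s = s /\ sop (sop t s) t = t }.

Arguments sop {i} _ _.

Definition idempotent (S : InverseSemigroup) (e : S) : Prop := sop e e = e.

Definition natural_le (S : InverseSemigroup) (s t : S) : Prop :=
  exists e : S, idempotent S e /\ s = sop t e.

Definition prehomomorphism (S T : InverseSemigroup) (f : S -> T) : Prop :=
  forall s t : S, natural_le T (f (sop s t)) (sop (f s) (f t)).

Definition homomorphism (S T : InverseSemigroup) (f : S -> T) : Prop :=
  forall s t : S, f (sop s t) = sop (f s) (f t).

Section InverseSemigroupFacts.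

Variable S : InverseSemigroup.

Lemma inverse_ex (s : S) :
  exists t : S, sop (sop s t) s = s /\ sop (sop t s) t = t.
Proof. destruct (sop_inverse S s) as [t [Ht _]]. exists t. exact Ht. Qed.

Lemma inverse_uniq (s t u : S) :
  sop (sop s t) s = s -> sop (sop t s) t = t ->
  sop (sop s u) s = s -> sop (sop u s) u = u -> t = u.
Proof.
intros. destruct (sop_inverse S s) as [v [_ Hv]].
rewrite <- (Hv t), <- (Hv u); auto.
Qed.

Lemma idempotent_op (e f : S) :
  idempotent S e -> idempotent S f -> idempotent S (sop e f).
Proof.
unfold idempotent. intros He Hf.
assert (He' : forall y, sop e (sop e y) = sop e y)
  by (intros; rewrite sop_assoc, He; reflexivity).
assert (Hf' : forall y, sop f (sop f y) = sop f y)
  by (intros; rewrite sop_assoc, Hf; reflexivity).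
destruct (inverse_ex (sop e f)) as [x [H1 H2]].
assert (H2' : forall y, sop x (sop e (sop f (sop x y))) = sop x y).
{ intros y. rewrite <- H2 at 3. rewrite <- !sop_assoc. reflexivity. }
assert (Hx : x = sop f (sop x e)).
{ apply (@inverse_uniq (sop e f)); auto; rewrite <- !sop_assoc in *.
  - rewrite Hf', He'. exact H1.
  - rewrite Hf', He', H2'. reflexivity. }
assert (Hxx : sop x x = x).
{ rewrite Hx. rewrite <- !sop_assoc. rewrite H2'. reflexivity. }
assert (E : sop e f = x).
{ apply (@inverse_uniq x); auto; rewrite Hxx; exact Hxx. }
rewrite E. exact Hxx.
Qed.

Lemma idempotent_comm (e f : S) :
  idempotent S e -> idempotent S f -> sop e f = sop f e.
Proof.
intros He Hf.
pose proof (idempotent_op He Hf) as Hef.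
pose proof (idempotent_op Hf He) as Hfe.
unfold idempotent in *.
assert (He' : forall y, sop e (sop e y) = sop e y)
  by (intros; rewrite sop_assoc, He; reflexivity).
assert (Hf' : forall y, sop f (sop f y) = sop f y)
  by (intros; rewrite sop_assoc, Hf; reflexivity).
apply (@inverse_uniq (sop e f)); rewrite ?Hef; auto;
  rewrite <- !sop_assoc in *; rewrite ?He', ?Hf', ?He', ?Hf'; assumption.
Qed.

Lemma natural_le_refl (s : S) : natural_le S s s.
Proof.
destruct (inverse_ex s) as [t [H1 H2]].
exists (sop t s). unfold idempotent.
split; rewrite sop_assoc; [rewrite H2 | rewrite H1]; reflexivity.
Qed.

Lemma natural_le_trans (s t u : S) :
  natural_le S s t -> natural_le S t u -> natural_le S s u.
Proof.
intros [e [He ->]] [f [Hf ->]]. exists (sop f e).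
split; [apply idempotent_op; assumption | symmetry; apply sop_assoc].
Qed.

Lemma natural_le_square (a : S) : natural_le S a (sop a a) -> idempotent S a.
Proof.
intros [f [Hf Ha]].
destruct (inverse_ex a) as [b [H1 H2]].
assert (Hd : idempotent S (sop b a))
  by (unfold idempotent; rewrite sop_assoc, H2; reflexivity).
assert (Hr : idempotent S (sop a b))
  by (unfold idempotent; rewrite sop_assoc, H1; reflexivity).
pose proof (idempotent_comm Hd Hr) as Hc.
set (d := sop b a) in *.
set (c := sop b (sop d a)).
assert (Hda : sop d a = sop a c).
{ unfold c. rewrite <- H1 at 1. rewrite !sop_assoc.
  rewrite sop_assoc in Hc. rewrite Hc. reflexivity. }
assert (Hcc : idempotent S c).
{ unfold idempotent. unfold c at 1. rewrite <- !sop_assoc, <- Hda.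
  rewrite (sop_assoc S d d), Hd. reflexivity. }
set (k := sop c f).
assert (Hk : idempotent S k) by (apply idempotent_op; assumption).
assert (Hdk : d = sop a k).
{ unfold k. rewrite sop_assoc, <- Hda. unfold d.
  transitivity (sop b (sop (sop a a) f)).
  - rewrite <- Ha. reflexivity.
  - rewrite !sop_assoc. reflexivity. }
assert (Hdk' : sop d k = d).
{ rewrite Hdk at 1. rewrite <- sop_assoc, Hk. symmetry. exact Hdk. }
assert (Had : sop a d = d).
{ rewrite <- Hdk' at 1. rewrite (idempotent_comm Hd Hk), sop_assoc, <- Hdk.
  exact Hd. }
assert (E : a = d).
{ rewrite <- Had. unfold d. rewrite sop_assoc. symmetry. exact H1. }
rewrite E. exact Hd.
Qed.

End InverseSemigroupFacts.

Lemma prehomomorphism_id (S : InverseSemigroup) :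
  prehomomorphism S S (fun x => x).
Proof. intros s t. apply natural_le_refl. Qed.

Lemma prehomomorphism_le (S T : InverseSemigroup) (f : S -> T) :
  prehomomorphism S T f ->
  forall s t, natural_le S s t -> natural_le T (f s) (f t).
Proof.
intros Hf s t [e [He ->]].
apply natural_le_trans with (1 := Hf t e).
exists (f e). split; [| reflexivity].
apply natural_le_square. pose proof (Hf e e) as H. rewrite He in H. exact H.
Qed.

Lemma prehomomorphism_comp (S T U : InverseSemigroup)
    (g : T -> U) (f : S -> T) :
  prehomomorphism T U g -> prehomomorphism S T f ->
  prehomomorphism S U (fun x => g (f x)).
Proof.
intros Hg Hf s t.
apply natural_le_trans with (2 := Hg (f s) (f t)).
apply (prehomomorphism_le Hg), Hf.
Qed.

Lemma homomorphism_id (S : InverseSemigroup) : homomorphism S S (fun x => x).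
Proof. intros s t. reflexivity. Qed.

Lemma homomorphism_comp (S T U : InverseSemigroup)
    (g : T -> U) (f : S -> T) :
  homomorphism T U g -> homomorphism S T f ->
  homomorphism S U (fun x => g (f x)).
Proof. intros Hg Hf s t. rewrite Hf. apply Hg. Qed.

Definition InvSemigroup_prehom : Cat :=
  concrete_cat scar prehomomorphism prehomomorphism_id prehomomorphism_comp.

Definition InvSemigroup_hom : Cat :=
  concrete_cat scar homomorphism homomorphism_id homomorphism_comp.

Definition is_identity (C : Type) (mul : C -> C -> option C) (e : C) : Prop :=
  (forall x y, mul e x = Some y -> y = x) /\
  (forall x y, mul x e = Some y -> y = x).

(* A small category as a set of arrows with a partial product: [mul x y] is
   [Some z] when xy is defined and equal to z, and [None] when xy is not
   defined.  The fields [dom] and [rng] are determined by [mul]. *)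
Record ArrowCategory : Type := {
  arr :> Type;
  mul : arr -> arr -> option arr;
  dom : arr -> arr;
  rng : arr -> arr;
  dom_identity : forall x, is_identity mul (dom x);
  rng_identity : forall x, is_identity mul (rng x);
  mul_dom : forall x, mul x (dom x) = Some x;
  mul_rng : forall x, mul (rng x) x = Some x;
  mul_defined : forall x y, (exists z, mul x y = Some z) <-> dom x = rng y;
  dom_mul : forall x y z, mul x y = Some z -> dom z = dom y;
  rng_mul : forall x y z, mul x y = Some z -> rng z = rng x;
  mul_assoc : forall x y z u v,
    mul x y = Some u -> mul y z = Some v -> mul u z = mul x v }.

Arguments mul {a} _ _.
Arguments dom {a} _.
Arguments rng {a} _.

Definition identity (C : ArrowCategory) (e : C) : Prop := is_identity mul e.

(* The field [inv] is determined by the category. *)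
Record Groupoid : Type := {
  gcat :> ArrowCategory;
  inv : gcat -> gcat;
  mul_inv_r : forall x, mul x (inv x) = Some (rng x);
  mul_inv_l : forall x, mul (inv x) x = Some (dom x) }.

Arguments inv {g} _.

Record OrderedGroupoid : Type := {
  ogpd :> Groupoid;
  le : relation ogpd;
  le_order : order ogpd le;
  le_inv : forall x y, le x y -> le (inv x) (inv y);
  le_mul : forall x y u v xu yv, le x y -> le u v ->
    mul x u = Some xu -> mul y v = Some yv -> le xu yv;
  le_restriction : forall x e, identity ogpd e -> le e (dom x) ->
    exists! y, le y x /\ dom y = e;
  le_corestriction : forall x e, identity ogpd e -> le e (rng x) ->
    exists! y, le y x /\ rng y = e }.

Arguments le {o} _ _.

Definition identity_meet (G : OrderedGroupoid) (e f m : G) : Prop :=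
  identity G m /\ le m e /\ le m f /\
  forall h : G, identity G h -> le h e -> le h f -> le h m.

Record InductiveGroupoid : Type := {
  igpd :> OrderedGroupoid;
  meet_exists : forall e f, identity igpd e -> identity igpd f ->
    exists m, identity_meet igpd e f m }.

Definition ordered_functor (G H : OrderedGroupoid) (f : G -> H) : Prop :=
  (forall e, identity G e -> identity H (f e)) /\
  (forall x y z, mul x y = Some z -> mul (f x) (f y) = Some (f z)) /\
  (forall x y, le x y -> le (f x) (f y)).

Definition inductive_functor (G H : InductiveGroupoid) (f : G -> H) : Prop :=
  ordered_functor G H f /\
  (forall e e' m, identity G e -> identity G e' ->
    identity_meet G e e' m -> identity_meet H (f e) (f e') (f m)).

Lemma ordered_functor_id (G : InductiveGroupoid) :
  ordered_functor G G (fun x => x).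
Proof. repeat split; try apply H; auto. Qed.

Lemma ordered_functor_comp (G H K : InductiveGroupoid)
    (g : H -> K) (f : G -> H) :
  ordered_functor H K g -> ordered_functor G H f ->
  ordered_functor G K (fun x => g (f x)).
Proof.
intros [A1 [A2 A3]] [B1 [B2 B3]]. split; [| split]; auto.
Qed.

Lemma inductive_functor_id (G : InductiveGroupoid) :
  inductive_functor G G (fun x => x).
Proof. split; [apply ordered_functor_id | auto]. Qed.

Lemma inductive_functor_comp (G H K : InductiveGroupoid)
    (g : H -> K) (f : G -> H) :
  inductive_functor H K g -> inductive_functor G H f ->
  inductive_functor G K (fun x => g (f x)).
Proof.
intros [A1 A2] [B1 B2]. split; [apply (ordered_functor_comp G H K A1 B1) |].
intros e e' m He He' Hm. apply A2; auto; apply B1; assumption.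
Qed.

Definition IndGroupoid_ordered : Cat :=
  concrete_cat (fun G : InductiveGroupoid => arr G)
    (fun G H => ordered_functor G H)
    ordered_functor_id ordered_functor_comp.

Definition IndGroupoid_inductive : Cat :=
  concrete_cat (fun G : InductiveGroupoid => arr G)
    inductive_functor inductive_functor_id inductive_functor_comp.

(* Main.v *)
(** The semigroup attached to an inductive groupoid carries the pseudoproduct
    [s (x) t = (s|m)(m|t)] with [m] the meet of [dom s] and [rng t].  Everything
    rests on one description of it: the elements below [s (x) t] are exactly the
    groupoid products [s' t'] with [s' <= s] and [t' <= t].  Associativity,
    uniqueness of inverses, the agreement of the natural order with the given
    order, and the fact that ordered functors are prehomomorphisms all follow by
    comparing down-sets.  Conversely an inverse semigroup restricts its product
    to the pairs with [dom x = rng y].  The two constructions leave carriers and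
    underlying functions unchanged, so they are mutually inverse on the nose by
    extensionality. *)

Require Import Defs.
From Stdlib Require Import Relation_Definitions ProofIrrelevance ClassicalEpsilon
  FunctionalExtensionality PropExtensionality.

Set Implicit Arguments.

(** * Inverse semigroups *)

Section InverseSemigroupTheory.

Variable S : InverseSemigroup.
Implicit Types x y z e f s t : S.

Local Infix "*" := sop.

(** Inverses are not part of the structure; definite description extracts them from unique
    existence. *)
Definition sinv x : S :=
  proj1_sig (constructive_definite_description _ (sop_inverse S x)).

Definition sdom x : S := sinv x * x.
Definition srng x : S := x * sinv x.

Lemma sinv_spec x : x * sinv x * x = x /\ sinv x * x * sinv x = sinv x.
Proof.
unfold sinv.
destruct (constructive_definite_description _ (sop_inverse S x)) as [t Ht].
exact Ht.
Qed.

Lemma sop_sdom x : x * sdom x = x.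
Proof. unfold sdom. rewrite sop_assoc. apply sinv_spec. Qed.

Lemma srng_sop x : srng x * x = x.
Proof. apply sinv_spec. Qed.

Lemma sdom_sinv_op x : sdom x * sinv x = sinv x.
Proof. apply sinv_spec. Qed.

Lemma sinv_unique x y : x * y * x = x -> y * x * y = y -> sinv x = y.
Proof.
intros H1 H2. destruct (sinv_spec x). apply (@inverse_uniq S x); assumption.
Qed.

Lemma sinv_sinv x : sinv (sinv x) = x.
Proof. destruct (sinv_spec x). apply sinv_unique; assumption. Qed.

Lemma sdom_sinv x : sdom (sinv x) = srng x.
Proof. unfold sdom, srng. rewrite sinv_sinv. reflexivity. Qed.

Lemma srng_sinv x : srng (sinv x) = sdom x.
Proof. unfold sdom, srng. rewrite sinv_sinv. reflexivity. Qed.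

Lemma idempotent_sdom x : idempotent S (sdom x).
Proof.
unfold idempotent. unfold sdom at 2. rewrite sop_assoc, sdom_sinv_op.
reflexivity.
Qed.

Lemma idempotent_srng x : idempotent S (srng x).
Proof. rewrite <- sdom_sinv. apply idempotent_sdom. Qed.

Lemma idempotent_sinv e : idempotent S e -> sinv e = e.
Proof. intros He. apply sinv_unique; rewrite He; exact He. Qed.

Lemma idempotent_sdomE e : idempotent S e -> sdom e = e.
Proof. intros He. unfold sdom. rewrite idempotent_sinv; assumption. Qed.

Lemma idempotent_srngE e : idempotent S e -> srng e = e.
Proof. intros He. unfold srng. rewrite idempotent_sinv; assumption. Qed.

(** The idempotents [sdom x] and [srng y] commute; once swapped in [x * srng y * sdom x * y], each
    is absorbed by its neighbour. *)
Lemma sinv_op x y : sinv (x * y) = sinv y * sinv x.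
Proof.
pose proof (idempotent_comm (idempotent_sdom x) (idempotent_srng y)) as Hc.
apply sinv_unique.
- transitivity (x * (srng y * sdom x) * y).
  + unfold srng, sdom. rewrite !sop_assoc. reflexivity.
  + rewrite <- Hc, sop_assoc, sop_sdom, <- sop_assoc, srng_sop. reflexivity.
- transitivity (sinv y * (sdom x * srng y) * sinv x).
  + unfold srng, sdom. rewrite !sop_assoc. reflexivity.
  + rewrite Hc, <- srng_sinv, <- sdom_sinv, sop_assoc, sop_sdom, <- sop_assoc,
      srng_sop. reflexivity.
Qed.

Lemma sdom_op_idempotent x e : idempotent S e -> sdom (x * e) = sdom x * e.
Proof.
intros He. unfold sdom at 1. rewrite sinv_op, (idempotent_sinv He).
transitivity (e * sdom x * e).
- unfold sdom. rewrite !sop_assoc. reflexivity.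
- rewrite (idempotent_comm He (idempotent_sdom x)), <- sop_assoc, He.
  reflexivity.
Qed.

Lemma idempotent_conj x e : idempotent S e -> idempotent S (x * e * sinv x).
Proof.
intros He. replace (x * e * sinv x) with (srng (x * e)).
- apply idempotent_srng.
- unfold srng.
  rewrite sinv_op, (idempotent_sinv He), sop_assoc, <- (sop_assoc _ x e e), He.
  reflexivity.
Qed.

(** An idempotent moved past [x] becomes a conjugate idempotent. This makes the natural order,
    defined by factors on the right, symmetric in left and right. *)
Lemma idempotent_slide x e : idempotent S e -> e * x = x * (sinv x * e * x).
Proof.
intros He. rewrite !sop_assoc. fold (srng x).
rewrite (idempotent_comm (idempotent_srng x) He), <- sop_assoc, srng_sop.
reflexivity.
Qed.

Lemma natural_le_op_r x e : idempotent S e -> natural_le S (x * e) x.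
Proof. intros He. exists e. split; [exact He | reflexivity]. Qed.

Lemma natural_le_op_l x e : idempotent S e -> natural_le S (e * x) x.
Proof.
intros He. exists (sinv x * e * x). split.
- pose proof (idempotent_conj (sinv x) He) as H. rewrite sinv_sinv in H. exact H.
- apply idempotent_slide, He.
Qed.

(** The idempotent witnessing [s <= t] can be taken to be [sdom s], so an element below [t] is
    determined by its domain. *)
Lemma natural_le_sdomE s t : natural_le S s t -> s = t * sdom s.
Proof.
intros [e [He ->]].
rewrite (sdom_op_idempotent t He), sop_assoc, sop_sdom. reflexivity.
Qed.

Lemma natural_le_sinv s t : natural_le S s t -> natural_le S (sinv s) (sinv t).
Proof.
intros [e [He ->]]. rewrite sinv_op, (idempotent_sinv He).
apply natural_le_op_l, He.
Qed.

Lemma natural_le_srngE s t : natural_le S s t -> s = srng s * t.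
Proof.
intros H. rewrite <- (sinv_sinv s) at 1.
rewrite (natural_le_sdomE (natural_le_sinv H)), sinv_op, sinv_sinv, sdom_sinv.
rewrite (idempotent_sinv (idempotent_srng s)). reflexivity.
Qed.

Lemma natural_le_op s t u v :
  natural_le S s t -> natural_le S u v -> natural_le S (s * u) (t * v).
Proof.
intros [e [He ->]] [f [Hf ->]].
apply natural_le_trans with (t * e * v).
- rewrite sop_assoc. apply natural_le_op_r, Hf.
- rewrite <- sop_assoc, (idempotent_slide v He), sop_assoc.
  apply natural_le_op_r.
  pose proof (idempotent_conj (sinv v) He) as H. rewrite sinv_sinv in H. exact H.
Qed.

Lemma natural_le_sdom s t :
  natural_le S s t -> natural_le S (sdom s) (sdom t).
Proof. intros H. apply natural_le_op; [apply natural_le_sinv|]; exact H. Qed.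

Lemma natural_le_idempotent e f :
  idempotent S f -> natural_le S e f -> e = f * e.
Proof.
intros Hf [g [Hg ->]]. rewrite sop_assoc, Hf. reflexivity.
Qed.

Lemma natural_le_antisym s t : natural_le S s t -> natural_le S t s -> s = t.
Proof.
intros [e [He Hs]] [f [Hf Ht]].
assert (Hse : s * e = s) by (rewrite Hs, <- sop_assoc, He; reflexivity).
rewrite Hs. rewrite Ht at 1.
rewrite <- sop_assoc, (idempotent_comm Hf He), sop_assoc, Hse. symmetry. exact Ht.
Qed.

Lemma natural_le_sdom_eq s t : natural_le S s t -> sdom s = sdom t -> s = t.
Proof.
intros H E. rewrite (natural_le_sdomE H), E. apply sop_sdom.
Qed.

(** An inequality form of the uniqueness of inverses. Substituting [s = s * t * s * e] into
    [sinv s * s * sinv s] leaves [t] between the idempotents [sdom s] and [s * e * sinv s]. *)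
Lemma sinv_natural_le s t : natural_le S s (s * t * s) -> natural_le S (sinv s) t.
Proof.
intros [e [He Hs]].
assert (E : sinv s = sdom s * t * (s * e * sinv s)).
{ rewrite <- sdom_sinv_op at 1. unfold sdom at 1. rewrite Hs at 2.
  unfold sdom. rewrite !sop_assoc. reflexivity. }
rewrite E. apply natural_le_trans with (sdom s * t).
- apply natural_le_op_r, idempotent_conj, He.
- apply natural_le_op_l, idempotent_sdom.
Qed.

(** * The restricted product and the inductive groupoid of an inverse semigroup *)

Definition rmul x y : option S :=
  if excluded_middle_informative (sdom x = srng y) then Some (x * y) else None.

Lemma rmul_some x y z : rmul x y = Some z <-> sdom x = srng y /\ z = x * y.
Proof.
unfold rmul. destruct (excluded_middle_informative _) as [H | H]; split.
- intros [=]. auto.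
- intros [_ ->]. reflexivity.
- discriminate.
- intros [H' _]. contradiction.
Qed.

Lemma idempotent_is_identity e : idempotent S e -> is_identity rmul e.
Proof.
intros He. split; intros x y H; apply rmul_some in H; destruct H as [H ->].
- rewrite (idempotent_sdomE He) in H. rewrite H. apply srng_sop.
- rewrite (idempotent_srngE He) in H. rewrite <- H. apply sop_sdom.
Qed.

(** The restricted product of [e] and [sdom e] is defined with value [e]; as [e] is an identity, the
    value is also [sdom e]. *)
Lemma is_identity_idempotent e : is_identity rmul e -> idempotent S e.
Proof.
intros [He _]. replace e with (sdom e); [apply idempotent_sdom |].
symmetry. apply He, rmul_some. split.
- symmetry. apply idempotent_srngE, idempotent_sdom.
- symmetry. apply sop_sdom.
Qed.

Lemma sdom_op x y : sdom x = srng y -> sdom (x * y) = sdom y.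
Proof.
intros H. unfold sdom. rewrite sinv_op.
transitivity (sinv y * (sdom x * y)).
- unfold sdom. rewrite !sop_assoc. reflexivity.
- rewrite H, srng_sop. reflexivity.
Qed.

Lemma srng_op x y : sdom x = srng y -> srng (x * y) = srng x.
Proof.
intros H. rewrite <- !sdom_sinv, sinv_op. apply sdom_op.
rewrite sdom_sinv, srng_sinv. symmetry. exact H.
Qed.

Definition restricted_category : ArrowCategory.
Proof.
refine {| arr := S; mul := rmul; dom := sdom; rng := srng |}.
- intros x. apply idempotent_is_identity, idempotent_sdom.
- intros x. apply idempotent_is_identity, idempotent_srng.
- intros x. apply rmul_some. rewrite sop_sdom. split; [| reflexivity].
  symmetry. apply idempotent_srngE, idempotent_sdom.
- intros x. apply rmul_some. rewrite srng_sop. split; [| reflexivity].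
  apply idempotent_sdomE, idempotent_srng.
- intros x y. split.
  + intros [z Hz]. apply rmul_some in Hz. apply Hz.
  + intros H. exists (x * y). apply rmul_some. auto.
- intros x y z H. apply rmul_some in H. destruct H as [H ->].
  apply sdom_op, H.
- intros x y z H. apply rmul_some in H. destruct H as [H ->].
  apply srng_op, H.
- intros x y z u v Hu Hv. apply rmul_some in Hu, Hv.
  destruct Hu as [Hxy ->], Hv as [Hyz ->].
  transitivity (Some (x * y * z)); [| symmetry]; apply rmul_some; split.
  + rewrite sdom_op; assumption.
  + reflexivity.
  + rewrite srng_op; assumption.
  + symmetry. apply sop_assoc.
Defined.

Definition restricted_groupoid : Groupoid.
Proof.
refine {| gcat := restricted_category; inv := sinv : _ -> restricted_category |}.
- intros x. apply rmul_some. rewrite srng_sinv. auto.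
- intros x. apply rmul_some. rewrite sdom_sinv. auto.
Defined.

(** Restriction and corestriction of [x] to [e] are [x * e] and [e * x]; they are unique because an
    element below [x] is recovered from its domain, or from its range. *)
Definition restricted_ordered_groupoid : OrderedGroupoid.
Proof.
refine {| ogpd := restricted_groupoid;
          le := natural_le S : relation restricted_groupoid |}.
- split.
  + exact (@natural_le_refl S).
  + exact (@natural_le_trans S).
  + exact natural_le_antisym.
- exact natural_le_sinv.
- intros x y u v xu yv Hxy Huv Hxu Hyv. apply rmul_some in Hxu, Hyv.
  destruct Hxu as [_ ->], Hyv as [_ ->]. apply natural_le_op; assumption.
- intros x e He Hle. apply is_identity_idempotent in He.
  simpl in *. exists (x * e). split; [split |].
  + apply natural_le_op_r, He.
  + rewrite sdom_op_idempotent by exact He. symmetry.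
    apply natural_le_idempotent; [apply idempotent_sdom | exact Hle].
  + intros y [Hy <-]. symmetry. apply natural_le_sdomE, Hy.
- intros x e He Hle. apply is_identity_idempotent in He.
  simpl in *. exists (e * x). split; [split |].
  + apply natural_le_op_l, He.
  + rewrite <- sdom_sinv, sinv_op, (idempotent_sinv He).
    rewrite sdom_op_idempotent by exact He. rewrite sdom_sinv. symmetry.
    apply natural_le_idempotent; [apply idempotent_srng | exact Hle].
  + intros y [Hy <-]. symmetry. apply natural_le_srngE, Hy.
Defined.

Lemma identity_meet_sop e f : idempotent S e -> idempotent S f ->
  identity_meet restricted_ordered_groupoid e f (e * f).
Proof.
intros He Hf. split; [| split; [| split]].
- apply idempotent_is_identity, idempotent_op; assumption.
- apply natural_le_op_r, Hf.
- apply natural_le_op_l, He.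
- intros h Hh Hhe Hhf. apply is_identity_idempotent in Hh. simpl in *.
  exists h. split; [exact Hh |].
  rewrite <- sop_assoc, <- (natural_le_idempotent Hf Hhf).
  apply natural_le_idempotent; assumption.
Qed.

Definition groupoid_of_semigroup : InductiveGroupoid.
Proof.
refine {| igpd := restricted_ordered_groupoid |}.
intros e f He Hf. apply is_identity_idempotent in He, Hf.
exists (e * f). apply identity_meet_sop; assumption.
Defined.

End InverseSemigroupTheory.

(** * Prehomomorphisms as ordered functors *)

Section Prehomomorphisms.

Variables (S T : InverseSemigroup) (f : S -> T).

Lemma homomorphism_prehomomorphism :
  homomorphism S T f -> prehomomorphism S T f.
Proof. intros Hf s t. rewrite Hf. apply natural_le_refl. Qed.

Hypothesis Hf : prehomomorphism S T f.

Lemma prehomomorphism_idempotent e : idempotent S e -> idempotent T (f e).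
Proof.
intros He. apply natural_le_square. pose proof (Hf e e) as H.
rewrite He in H. exact H.
Qed.

Lemma prehomomorphism_op3 s t :
  sop (sop s t) s = s -> natural_le T (f s) (sop (sop (f s) (f t)) (f s)).
Proof.
intros E. rewrite <- E at 1.
apply natural_le_trans with (sop (f (sop s t)) (f s)); [apply Hf |].
apply natural_le_op; [apply Hf | apply natural_le_refl].
Qed.

(** Applying [f] to the two inverse equations gives inequalities, which [sinv_natural_le] turns into
    [sinv (f s) <= f (sinv s)] and [sinv (f (sinv s)) <= f s]; inverting the latter gives the
    converse of the former. *)
Lemma prehomomorphism_sinv s : f (sinv S s) = sinv T (f s).
Proof.
destruct (sinv_spec S s) as [H1 H2].
apply prehomomorphism_op3, sinv_natural_le in H1, H2.
apply natural_le_antisym; [| exact H1].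
apply natural_le_sinv in H2. rewrite sinv_sinv in H2. exact H2.
Qed.

Lemma prehomomorphism_sdom s : f (sdom S s) = sdom T (f s).
Proof.
apply natural_le_antisym.
- unfold sdom. rewrite <- prehomomorphism_sinv. apply Hf.
- pose proof (prehomomorphism_idempotent (idempotent_sdom S s)) as He.
  (* Taking domains in [f s <= f s * f (sdom s)] bounds [sdom (f s)] by [f (sdom s)]. *)
  assert (H : natural_le T (f s) (sop (f s) (f (sdom S s))))
    by (rewrite <- (sop_sdom S s) at 1; apply Hf).
  apply natural_le_sdom in H. rewrite sdom_op_idempotent in H by exact He.
  apply natural_le_trans with (1 := H).
  apply natural_le_op_l, idempotent_sdom.
Qed.

Lemma prehomomorphism_srng s : f (srng S s) = srng T (f s).
Proof.
rewrite <- sdom_sinv, prehomomorphism_sdom, prehomomorphism_sinv.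
apply sdom_sinv.
Qed.

Lemma prehomomorphism_ordered_functor :
  ordered_functor (groupoid_of_semigroup S) (groupoid_of_semigroup T) f.
Proof.
split; [| split].
- intros e He. apply is_identity_idempotent in He.
  apply idempotent_is_identity, prehomomorphism_idempotent, He.
- intros x y z H. apply rmul_some in H. apply rmul_some.
  destruct H as [H ->].
  assert (H' : sdom T (f x) = srng T (f y))
    by (rewrite <- prehomomorphism_sdom, H; apply prehomomorphism_srng).
  split; [exact H' |].
  (* On a composable pair both sides of the prehomomorphism inequality have the same domain, so it
     becomes an equality. *)
  apply natural_le_sdom_eq; [apply Hf |].
  rewrite <- prehomomorphism_sdom, !sdom_op by assumption.
  apply prehomomorphism_sdom.
- exact (prehomomorphism_le Hf).
Qed.

End Prehomomorphisms.

(** * Ordered groupoids *)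

Section OrderedGroupoidTheory.

Context {G : OrderedGroupoid}.
Implicit Types x y z e p s t : G.

Lemma le_refl x : le x x.
Proof. apply (ord_refl _ _ (le_order G)). Qed.

Lemma le_trans [x y z] : le x y -> le y z -> le x z.
Proof. apply (ord_trans _ _ (le_order G)). Qed.

Lemma le_antisym x y : le x y -> le y x -> x = y.
Proof. apply (ord_antisym _ _ (le_order G)). Qed.

Lemma dom_rng_of_mul [x y z] : mul x y = Some z -> dom x = rng y.
Proof. intros H. apply mul_defined. exists z. exact H. Qed.

Lemma identity_dom [e] : identity G e -> dom e = e.
Proof. intros [He _]. symmetry. apply He, mul_dom. Qed.

Lemma identity_rng [e] : identity G e -> rng e = e.
Proof. intros [_ He]. symmetry. apply He, mul_rng. Qed.

Lemma dom_inv x : dom (inv x) = rng x.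
Proof. exact (dom_rng_of_mul (mul_inv_l G x)). Qed.

Lemma rng_inv x : rng (inv x) = dom x.
Proof. symmetry. exact (dom_rng_of_mul (mul_inv_r G x)). Qed.

Lemma mul_eq_right [x y] : mul x y = Some y -> x = rng y.
Proof.
intros H. pose proof (mul_assoc G _ _ _ H (mul_inv_r G y)) as E.
rewrite mul_inv_r in E. symmetry. apply (rng_identity G y). symmetry. exact E.
Qed.

(** Cancelling [s] in [u s = s] makes [u] the range of [s]; multiplying [s t = rng s] by [inv s] on
    the left isolates [t]. *)
Lemma inv_of_mul [s t u] : mul s t = Some u -> mul u s = Some s -> t = inv s.
Proof.
intros H1 H2. apply mul_eq_right in H2. subst u.
pose proof (mul_assoc G _ _ _ (mul_inv_l G s) H1) as E.
rewrite <- (dom_inv s), mul_dom in E. symmetry. exact (proj1 (dom_identity G s) _ _ E).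
Qed.

Lemma inv_inv x : inv (inv x) = x.
Proof.
symmetry. apply inv_of_mul with (dom x); [apply mul_inv_l |].
rewrite <- rng_inv. apply mul_rng.
Qed.

Lemma le_dom [x y] : le x y -> le (dom x) (dom y).
Proof.
intros H. exact (le_mul G _ _ _ _ (le_inv G _ _ H) H (mul_inv_l G x) (mul_inv_l G y)).
Qed.

Lemma le_rng [x y] : le x y -> le (rng x) (rng y).
Proof. intros H. rewrite <- !dom_inv. apply le_dom, le_inv, H. Qed.

(** Both [x] and [y] are the unique restriction of [z] to their common domain. *)
Lemma le_dom_eq [x y z] : le x z -> le y z -> dom x = dom y -> x = y.
Proof.
intros Hx Hy E.
destruct (le_restriction G z (dom_identity G x) (le_dom Hx)) as [w [_ Hw]].
rewrite <- (Hw x), <- (Hw y); auto.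
Qed.

Lemma le_rng_eq [x y z] : le x z -> le y z -> rng x = rng y -> x = y.
Proof.
intros Hx Hy E.
destruct (le_corestriction G z (rng_identity G x) (le_rng Hx)) as [w [_ Hw]].
rewrite <- (Hw x), <- (Hw y); auto.
Qed.

(** Both [x] and [dom x] lie below [e], and they have the same domain. *)
Lemma identity_le [e x] : identity G e -> le x e -> identity G x.
Proof.
intros He H. replace x with (dom x); [apply dom_identity |].
apply le_dom_eq with e; [| exact H |].
- rewrite <- (identity_dom He). apply le_dom, H.
- apply identity_dom, dom_identity.
Qed.

(** Restrict [y] to [dom p], then [x] to the range of the result. The product of the two lies below
    [z] and has the domain of [p], so it is [p]. *)
Lemma le_mul_split [x y z p] : mul x y = Some z -> le p z ->
  exists x' y', le x' x /\ le y' y /\ mul x' y' = Some p.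
Proof.
intros H Hp.
assert (Hd : le (dom p) (dom y))
  by (rewrite <- (dom_mul G _ _ H); apply le_dom, Hp).
destruct (le_restriction G y (dom_identity G p) Hd) as [y' [[Hy' Dy'] _]].
assert (Hr : le (rng y') (dom x))
  by (rewrite (dom_rng_of_mul H); apply le_rng, Hy').
destruct (le_restriction G x (rng_identity G y') Hr) as [x' [[Hx' Dx'] _]].
exists x', y'. split; [exact Hx' | split; [exact Hy' |]].
destruct (proj2 (mul_defined G x' y') Dx') as [q Hq].
rewrite Hq. f_equal. apply le_dom_eq with z.
- exact (le_mul G _ _ _ _ Hx' Hy' Hq H).
- exact Hp.
- rewrite (dom_mul G _ _ Hq). exact Dy'.
Qed.

Lemma identity_meet_unique e f m m' :
  identity_meet G e f m -> identity_meet G e f m' -> m = m'.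
Proof.
intros [I [A [B H]]] [I' [A' [B' H']]]. apply le_antisym; auto.
Qed.

End OrderedGroupoidTheory.

Section OrderedFunctorTheory.

Variables (G H : OrderedGroupoid) (f : G -> H).
Hypothesis Hf : ordered_functor G H f.

Lemma ordered_functor_dom x : dom (f x) = f (dom x).
Proof.
destruct Hf as [H1 [H2 _]].
rewrite (dom_rng_of_mul (H2 _ _ _ (mul_dom G x))).
apply identity_rng, H1, dom_identity.
Qed.

Lemma ordered_functor_rng x : rng (f x) = f (rng x).
Proof.
destruct Hf as [H1 [H2 _]].
rewrite <- (dom_rng_of_mul (H2 _ _ _ (mul_rng G x))).
apply identity_dom, H1, rng_identity.
Qed.

End OrderedFunctorTheory.

(** * The pseudoproduct *)

(** Kept as a relation, so that an element can be recognized as the pseudoproduct by exhibiting the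
    meet and the two restrictions. *)
Definition is_pseudoproduct (G : OrderedGroupoid) (s t p : G) : Prop :=
  exists m s' t', identity_meet G (dom s) (rng t) m /\
    le s' s /\ dom s' = m /\ le t' t /\ rng t' = m /\ mul s' t' = Some p.

Lemma is_pseudoproduct_unique (G : OrderedGroupoid) (s t p q : G) :
  is_pseudoproduct G s t p -> is_pseudoproduct G s t q -> p = q.
Proof.
intros [m [s1 [t1 [M [A1 [A2 [A3 [A4 A5]]]]]]]]
  [m' [s2 [t2 [M' [B1 [B2 [B3 [B4 B5]]]]]]]].
pose proof (identity_meet_unique M M') as Em.
assert (Es : s1 = s2) by (apply le_dom_eq with s; congruence).
assert (Et : t1 = t2) by (apply le_rng_eq with t; congruence).
congruence.
Qed.

Section Pseudoproduct.

Variable G : InductiveGroupoid.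
Implicit Types x y z e p s t : G.

Lemma pseudoproduct_exists s t : exists! p, is_pseudoproduct G s t p.
Proof.
destruct (meet_exists G (dom_identity G s) (rng_identity G t)) as [m Hm].
pose proof Hm as [I [A [B _]]].
destruct (le_restriction G s I A) as [s' [[Hs Ds] _]].
destruct (le_corestriction G t I B) as [t' [[Ht Rt] _]].
destruct (proj2 (mul_defined G s' t')) as [p Hp]; [congruence |].
assert (P : is_pseudoproduct G s t p)
  by (exists m, s', t'; repeat (split; [assumption |]); assumption).
exists p. split; [exact P |].
intros q Q. exact (is_pseudoproduct_unique P Q).
Qed.

Definition pseudoproduct s t : G :=
  proj1_sig (constructive_definite_description _ (pseudoproduct_exists s t)).

Lemma pseudoproduct_spec s t : is_pseudoproduct G s t (pseudoproduct s t).
Proof.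
unfold pseudoproduct.
destruct (constructive_definite_description _ (pseudoproduct_exists s t)).
assumption.
Qed.

(** For composable [s'] and [t'] below [s] and [t], the identity [dom s' = rng t'] is a lower bound
    of [dom s] and [rng t], hence lies below their meet [m]. So [s'] and [t'] already lie below the
    restrictions whose product is the pseudoproduct. *)
Lemma le_pseudoproduct s t p : le p (pseudoproduct s t) <->
  exists s' t', le s' s /\ le t' t /\ mul s' t' = Some p.
Proof.
destruct (pseudoproduct_spec s t) as [m [s1 [t1 [M [A1 [A2 [A3 [A4 A5]]]]]]]].
split.
- intros Hp. destruct (le_mul_split A5 Hp) as [s' [t' [B1 [B2 B3]]]].
  exists s', t'. eauto using le_trans.
- intros [s' [t' [B1 [B2 B3]]]].
  pose proof (dom_rng_of_mul B3) as E.
  assert (Hm : le (dom s') m).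
  { apply M; [apply dom_identity | apply le_dom, B1 |].
    rewrite E. apply le_rng, B2. }
  (* The restriction of [s1] to [dom s'] also lies below [s], so it coincides with [s']. *)
  assert (C1 : le s' s1).
  { rewrite <- A2 in Hm.
    destruct (le_restriction G s1 (dom_identity G s') Hm) as [w [[W1 W2] _]].
    rewrite (le_dom_eq B1 (le_trans W1 A1)); auto. }
  assert (C2 : le t' t1).
  { rewrite E, <- A4 in Hm.
    destruct (le_corestriction G t1 (rng_identity G t') Hm) as [w [[W1 W2] _]].
    rewrite (le_rng_eq B2 (le_trans W1 A3)); auto. }
  exact (le_mul G _ _ _ _ C1 C2 B3 A5).
Qed.

Lemma le_ext x y : (forall p : G, le p x <-> le p y) -> x = y.
Proof. intros H. apply le_antisym; apply H, le_refl. Qed.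

(** Both down-sets consist of the triple groupoid products of elements below [x], [y] and [z], where
    associativity is that of the category. *)
Lemma pseudoproduct_assoc x y z :
  pseudoproduct x (pseudoproduct y z) = pseudoproduct (pseudoproduct x y) z.
Proof.
apply le_ext. intros p. rewrite !le_pseudoproduct. split.
- intros [x' [q [Hx [Hq E]]]]. apply le_pseudoproduct in Hq.
  destruct Hq as [y' [z' [Hy [Hz F]]]].
  assert (D : dom x' = rng y')
    by (rewrite (dom_rng_of_mul E); exact (rng_mul G _ _ F)).
  apply mul_defined in D. destruct D as [r Hr].
  exists r, z'. split; [| split; [exact Hz |]].
  + apply le_pseudoproduct. eauto.
  + rewrite (mul_assoc G _ _ _ Hr F). exact E.
- intros [q [z' [Hq [Hz E]]]]. apply le_pseudoproduct in Hq.
  destruct Hq as [x' [y' [Hx [Hy F]]]].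
  assert (D : dom y' = rng z')
    by (rewrite <- (dom_rng_of_mul E); symmetry; exact (dom_mul G _ _ F)).
  apply mul_defined in D. destruct D as [r Hr].
  exists x', r. split; [exact Hx | split].
  + apply le_pseudoproduct. eauto.
  + rewrite <- (mul_assoc G _ _ _ F Hr). exact E.
Qed.

Lemma pseudoproduct_mul x y z : mul x y = Some z -> pseudoproduct x y = z.
Proof.
intros H. apply le_ext. intros p. rewrite le_pseudoproduct. split.
- intros [x' [y' [Hx [Hy E]]]]. exact (le_mul G _ _ _ _ Hx Hy E H).
- intros Hp. exact (le_mul_split H Hp).
Qed.

Lemma pseudoproduct_inv_r x : pseudoproduct x (inv x) = rng x.
Proof. apply pseudoproduct_mul, mul_inv_r. Qed.

Lemma pseudoproduct_inv_l x : pseudoproduct (inv x) x = dom x.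
Proof. apply pseudoproduct_mul, mul_inv_l. Qed.

Lemma pseudoproduct_inv3 x : pseudoproduct (pseudoproduct x (inv x)) x = x.
Proof. rewrite pseudoproduct_inv_r. apply pseudoproduct_mul, mul_rng. Qed.

(* The factors of [s = s1 t' s2] below share the range, respectively the
   domain, of [s], which forces [s1 = s2 = s] and hence [t' = inv s]. *)
Lemma inv_le_of_pseudoproduct s t :
  pseudoproduct (pseudoproduct s t) s = s -> le (inv s) t.
Proof.
intros H.
assert (Hs : le s (pseudoproduct (pseudoproduct s t) s))
  by (rewrite H; apply le_refl).
apply le_pseudoproduct in Hs. destruct Hs as [q [s2 [Hq [Hs2 E]]]].
apply le_pseudoproduct in Hq. destruct Hq as [s1 [t' [Hs1 [Ht F]]]].
assert (E1 : s1 = s).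
{ apply le_rng_eq with s; [exact Hs1 | apply le_refl |].
  rewrite <- (rng_mul G _ _ F). symmetry. exact (rng_mul G _ _ E). }
assert (E2 : s2 = s).
{ apply le_dom_eq with s; [exact Hs2 | apply le_refl |].
  symmetry. exact (dom_mul G _ _ E). }
subst s1 s2. rewrite <- (inv_of_mul F E). exact Ht.
Qed.

(** The two equations give [inv s <= t] and [inv t <= s]; inverting the second yields
    [t <= inv s]. *)
Lemma inv_unique s t :
  pseudoproduct (pseudoproduct s t) s = s ->
  pseudoproduct (pseudoproduct t s) t = t -> inv s = t.
Proof.
intros H1 H2. apply inv_le_of_pseudoproduct in H1, H2.
apply le_antisym; [exact H1 |].
rewrite <- (inv_inv t). apply le_inv, H2.
Qed.

(** * The inverse semigroup of an inductive groupoid, its idempotents and its natural order *)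

Definition semigroup_of_groupoid : InverseSemigroup.
Proof.
refine {| scar := G; sop := pseudoproduct |}.
- exact pseudoproduct_assoc.
- intros s. exists (inv s). split; [split |].
  + apply pseudoproduct_inv3.
  + pose proof (pseudoproduct_inv3 (inv s)) as H. rewrite inv_inv in H. exact H.
  + intros t [H1 H2]. apply inv_unique; assumption.
Defined.

(** The pseudoproduct factors as [x' e'] with [e' <= e]; since [e'] is itself an identity, the
    product is just [x']. *)
Lemma pseudoproduct_identity x e : identity G e ->
  le (pseudoproduct x e) x /\ le (dom (pseudoproduct x e)) e.
Proof.
intros He.
pose proof (proj1 (le_pseudoproduct x e _) (le_refl _))
  as [x' [e' [Hx [He' E]]]].
pose proof (identity_le He He') as I.
rewrite (dom_mul G _ _ E), (identity_dom I).
apply I in E. rewrite E. split; assumption.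
Qed.

(** Writing [e] as a groupoid product of elements below it forces both factors to be [e], by their
    range and domain; then [e e = e] can be cancelled. *)
Lemma pseudoproduct_idempotent e : pseudoproduct e e = e -> identity G e.
Proof.
intros H. assert (He : le e (pseudoproduct e e)) by (rewrite H; apply le_refl).
apply le_pseudoproduct in He. destruct He as [e1 [e2 [H1 [H2 E]]]].
assert (E1 : e1 = e).
{ apply le_rng_eq with e; [exact H1 | apply le_refl |].
  symmetry. exact (rng_mul G _ _ E). }
assert (E2 : e2 = e).
{ apply le_dom_eq with e; [exact H2 | apply le_refl |].
  symmetry. exact (dom_mul G _ _ E). }
subst e1 e2. rewrite (mul_eq_right E). apply rng_identity.
Qed.

Lemma natural_le_pseudoproduct s t :
  natural_le semigroup_of_groupoid s t <-> le s t.
Proof.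
split.
- intros [e [He ->]]. apply pseudoproduct_idempotent in He.
  apply (pseudoproduct_identity t He).
(* Both [s] and the pseudoproduct of [t] with [dom s] lie below [t], so it is enough to compare
   domains; one inequality comes from [s = s (dom s)]. *)
- intros H. exists (dom s). split.
  + apply pseudoproduct_mul.
    rewrite <- (identity_dom (dom_identity G s)) at 2. apply mul_dom.
  + simpl. pose proof (pseudoproduct_identity t (dom_identity G s)) as [H1 H2].
    apply le_dom_eq with t; [exact H | exact H1 |].
    apply le_antisym; [| exact H2]. apply le_dom, le_pseudoproduct.
    exists s, (dom s). split; [exact H | split; [apply le_refl | apply mul_dom]].
Qed.

Lemma sinv_semigroup_of_groupoid s : sinv semigroup_of_groupoid s = inv s.
Proof.
symmetry. apply inv_unique; apply (sinv_spec semigroup_of_groupoid s).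
Qed.

End Pseudoproduct.

(** * Correspondence of the morphisms *)

Lemma ordered_functor_prehomomorphism (G H : InductiveGroupoid) (f : G -> H) :
  ordered_functor G H f ->
  prehomomorphism (semigroup_of_groupoid G) (semigroup_of_groupoid H) f.
Proof.
intros [_ [F2 F3]] s t. apply natural_le_pseudoproduct, le_pseudoproduct.
pose proof (proj1 (le_pseudoproduct G s t _) (le_refl _))
  as [s' [t' [Hs [Ht E]]]].
exists (f s'), (f t'). auto.
Qed.

(** The functor carries the meet and the two restrictions that witness a pseudoproduct to witnesses
    for the images; preservation of meets is what handles [m]. *)
Lemma inductive_functor_homomorphism (G H : InductiveGroupoid) (f : G -> H) :
  inductive_functor G H f ->
  homomorphism (semigroup_of_groupoid G) (semigroup_of_groupoid H) f.
Proof.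
intros [F1 F2] s t.
apply (@is_pseudoproduct_unique H (f s) (f t)); [| apply pseudoproduct_spec].
destruct (pseudoproduct_spec G s t) as [m [s' [t' [M [A1 [A2 [A3 [A4 A5]]]]]]]].
exists (f m), (f s'), (f t').
rewrite !(ordered_functor_dom F1), !(ordered_functor_rng F1), A2, A4.
destruct F1 as [_ [F1 F3]].
split; [apply F2; [apply dom_identity | apply rng_identity | exact M] | auto 10].
Qed.

(** Meets of identities are products of idempotents, which a homomorphism preserves. *)
Lemma homomorphism_inductive_functor (S T : InverseSemigroup) (f : S -> T) :
  homomorphism S T f ->
  inductive_functor (groupoid_of_semigroup S) (groupoid_of_semigroup T) f.
Proof.
intros Hf. pose proof (homomorphism_prehomomorphism Hf) as Hp. split.
- apply prehomomorphism_ordered_functor, Hp.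
- intros e e' m He He' Hm. apply is_identity_idempotent in He, He'.
  rewrite (identity_meet_unique Hm (identity_meet_sop He He')), Hf.
  apply identity_meet_sop; apply prehomomorphism_idempotent; assumption.
Qed.

(** * The two constructions are mutually inverse *)

(* The carriers are equated by [c] so that the lemma applies, with [c] the
   reflexivity proof, to structures whose carriers are only convertible. *)
Lemma InverseSemigroup_ext (S T : InverseSemigroup) (c : scar S = scar T) :
  (forall x y, eq_rect _ (fun A => A) (sop x y) _ c =
     sop (eq_rect _ (fun A => A) x _ c) (eq_rect _ (fun A => A) y _ c)) ->
  S = T.
Proof.
destruct S as [A op p1 p2], T as [B op' q1 q2]. simpl in *. subst B. simpl.
intros H.
assert (E : op = op') by (extensionality x; extensionality y; apply H).
subst op'. f_equal; apply proof_irrelevance.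
Qed.

Lemma InductiveGroupoid_ext (G H : InductiveGroupoid) (c : arr G = arr H) :
  let k := fun x : G => eq_rect _ (fun A => A) x _ c : H in
  (forall x y, option_map k (mul x y) = mul (k x) (k y)) ->
  (forall x, k (dom x) = dom (k x)) ->
  (forall x, k (rng x) = rng (k x)) ->
  (forall x, k (inv x) = inv (k x)) ->
  (forall x y, le x y <-> le (k x) (k y)) ->
  G = H.
Proof.
destruct G as [[[[A m d r p1 p2 p3 p4 p5 p6 p7 p8] i p9 p10] l p11 p12 p13 p14 p15] p16],
  H as [[[[B m' d' r' q1 q2 q3 q4 q5 q6 q7 q8] i' q9 q10] l' q11 q12 q13 q14 q15] q16].
simpl in *. subst B. simpl. intros Hm Hd Hr Hi Hl.
assert (E : m = m').
{ extensionality x. extensionality y. rewrite <- Hm.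
  destruct (m x y); reflexivity. }
subst m'. clear Hm.
assert (E : d = d') by (extensionality x; apply Hd). subst d'.
assert (E : r = r') by (extensionality x; apply Hr). subst r'.
assert (E : i = i') by (extensionality x; apply Hi). subst i'.
assert (E : l = l')
  by (extensionality x; extensionality y; apply propositional_extensionality, Hl).
subst l'.
(* Once the data coincide, the axioms on both sides are proofs of the same propositions. *)
repeat match goal with
| p : ?P, q : ?P |- _ => destruct (proof_irrelevance P p q)
end.
reflexivity.
Qed.

Lemma semigroup_of_groupoid_of_semigroup (S : InverseSemigroup) :
  semigroup_of_groupoid (groupoid_of_semigroup S) = S.
Proof.
apply (@InverseSemigroup_ext
  (semigroup_of_groupoid (groupoid_of_semigroup S)) S eq_refl). simpl. intros s t.
apply (@is_pseudoproduct_unique (groupoid_of_semigroup S) s t);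
  [apply pseudoproduct_spec |].
pose proof (idempotent_sdom S s) as Hs. pose proof (idempotent_srng S t) as Ht.
pose proof (idempotent_op Hs Ht) as Hm.
set (m := sop (sdom S s) (srng S t)) in *.
assert (D : sdom S (sop s m) = m).
{ rewrite sdom_op_idempotent by exact Hm. unfold m. rewrite sop_assoc, Hs.
  reflexivity. }
assert (R : srng S (sop m t) = m).
{ rewrite <- sdom_sinv, sinv_op, (idempotent_sinv Hm).
  rewrite sdom_op_idempotent by exact Hm. rewrite sdom_sinv. unfold m.
  rewrite (idempotent_comm Hs Ht), sop_assoc, Ht. reflexivity. }
(* The meet of [sdom s] and [srng t] is their product [m], and [s * m * m * t] collapses to
   [s * t]. *)
exists m, (sop s m), (sop m t). split; [| split; [| split; [| split; [| split]]]].
- apply identity_meet_sop; assumption.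
- apply natural_le_op_r, Hm.
- exact D.
- apply natural_le_op_l, Hm.
- exact R.
- apply rmul_some. split; [congruence |].
  rewrite sop_assoc, <- (sop_assoc S s m m), Hm. unfold m.
  rewrite sop_assoc, sop_sdom, <- sop_assoc, srng_sop. reflexivity.
Qed.

Lemma groupoid_of_semigroup_of_groupoid (G : InductiveGroupoid) :
  groupoid_of_semigroup (semigroup_of_groupoid G) = G.
Proof.
assert (Hd : forall x, sdom (semigroup_of_groupoid G) x = dom x).
{ intros x. unfold sdom. rewrite sinv_semigroup_of_groupoid.
  apply pseudoproduct_inv_l. }
assert (Hr : forall x, srng (semigroup_of_groupoid G) x = rng x).
{ intros x. unfold srng. rewrite sinv_semigroup_of_groupoid.
  apply pseudoproduct_inv_r. }
apply (@InductiveGroupoid_ext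
  (groupoid_of_semigroup (semigroup_of_groupoid G)) G eq_refl); simpl.
(* Transport along [eq_refl] is the identity, so [option_map] disappears by cases. What remains is
   that both products are defined on the same pairs and agree there. *)
- intros x y. transitivity (rmul (semigroup_of_groupoid G) x y).
  { destruct (rmul (semigroup_of_groupoid G) x y); reflexivity. }
  destruct (mul x y) as [z |] eqn:E.
  + apply (rmul_some (semigroup_of_groupoid G) x y z). rewrite Hd, Hr. split.
    * exact (dom_rng_of_mul E).
    * symmetry. apply pseudoproduct_mul, E.
  + destruct (rmul (semigroup_of_groupoid G) x y) as [z |] eqn:F;
      [| reflexivity].
    apply (rmul_some (semigroup_of_groupoid G) x y z) in F. rewrite Hd, Hr in F. destruct F as [F _].
    apply mul_defined in F. destruct F. congruence.
- exact Hd.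
- exact Hr.
- apply sinv_semigroup_of_groupoid.
- apply natural_le_pseudoproduct.
Qed.

(** The carrier equations [c] allow underlying functions to be compared without transporting along
    [F A = A]. *)
Lemma concrete_functor_eq_id (O : Type) (car : O -> Type) P P_id P_cmp
    (F : Functor (@concrete_cat O car P P_id P_cmp)
                 (@concrete_cat O car P P_id P_cmp))
    (c : forall A : O, car A = car (F A)) :
  (forall A : O, F A = A) ->
  (forall (A B : O) (f : {f : car A -> car B | P A B f}) (x : car A),
     proj1_sig (fmap F (A := A) (B := B) f) (eq_rect _ (fun X => X) x _ (c A)) =
     eq_rect _ (fun X => X) (proj1_sig f x) _ (c B)) ->
  F = functor_id _.
Proof.
destruct F as [Fo Fm Fi Fc]. simpl in *. intros Ho Hm.
assert (E : Fo = fun A => A) by (extensionality A; apply Ho).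
subst Fo.
assert (E : Fm = fun A B f => f).
{ extensionality A. extensionality B. extensionality f.
  specialize (Hm A B f).
  (* The object map is now the identity, so [c A] proves [car A = car A] and its transport
     vanishes. *)
  rewrite (proof_irrelevance _ (c A) eq_refl) in Hm.
  rewrite (proof_irrelevance _ (c B) eq_refl) in Hm. simpl in Hm.
  destruct (Fm A B f) as [g Hg], f as [f Hf]. simpl in *.
  apply subset_eq_compat. extensionality x. apply Hm. }
subst Fm. unfold functor_id. f_equal; apply proof_irrelevance.
Qed.

(** * The functors and the two isomorphisms *)

Definition prehom_to_ordered : Functor InvSemigroup_prehom IndGroupoid_ordered.
Proof.
refine (Build_Functor InvSemigroup_prehom IndGroupoid_ordered
  groupoid_of_semigroup
  (fun A B f => exist _ (proj1_sig f)
     (prehomomorphism_ordered_functor (proj2_sig f))) _ _).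
- intros A. apply subset_eq_compat. reflexivity.
- intros A B C g f. apply subset_eq_compat. reflexivity.
Defined.

Definition ordered_to_prehom : Functor IndGroupoid_ordered InvSemigroup_prehom.
Proof.
refine (Build_Functor IndGroupoid_ordered InvSemigroup_prehom
  semigroup_of_groupoid
  (fun A B f => exist _ (proj1_sig f)
     (@ordered_functor_prehomomorphism A B _ (proj2_sig f))) _ _).
- intros A. apply subset_eq_compat. reflexivity.
- intros A B C g f. apply subset_eq_compat. reflexivity.
Defined.

Definition hom_to_inductive : Functor InvSemigroup_hom IndGroupoid_inductive.
Proof.
refine (Build_Functor InvSemigroup_hom IndGroupoid_inductive
  groupoid_of_semigroup
  (fun A B f => exist _ (proj1_sig f)
     (homomorphism_inductive_functor (proj2_sig f))) _ _).
- intros A. apply subset_eq_compat. reflexivity.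
- intros A B C g f. apply subset_eq_compat. reflexivity.
Defined.

Definition inductive_to_hom : Functor IndGroupoid_inductive InvSemigroup_hom.
Proof.
refine (Build_Functor IndGroupoid_inductive InvSemigroup_hom
  semigroup_of_groupoid
  (fun A B f => exist _ (proj1_sig f)
     (inductive_functor_homomorphism (proj2_sig f))) _ _).
- intros A. apply subset_eq_compat. reflexivity.
- intros A B C g f. apply subset_eq_compat. reflexivity.
Defined.

Theorem theorem2p10 :
  isomorphic_categories InvSemigroup_prehom IndGroupoid_ordered /\
  isomorphic_categories InvSemigroup_hom IndGroupoid_inductive.
Proof.
split.
- exists prehom_to_ordered, ordered_to_prehom. split.
  (* The composite preserves carriers and underlying functions up to conversion, so [eq_refl] serves
     as carrier equation and the condition on maps holds by [reflexivity]. *)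
  + apply (concrete_functor_eq_id
      (functor_comp ordered_to_prehom prehom_to_ordered)
      (fun A => eq_refl)).
    * exact semigroup_of_groupoid_of_semigroup.
    * reflexivity.
  + apply (concrete_functor_eq_id
      (functor_comp prehom_to_ordered ordered_to_prehom)
      (fun A => eq_refl)).
    * exact groupoid_of_semigroup_of_groupoid.
    * reflexivity.
- exists hom_to_inductive, inductive_to_hom. split.
  + apply (concrete_functor_eq_id
      (functor_comp inductive_to_hom hom_to_inductive)
      (fun A => eq_refl)).
    * exact semigroup_of_groupoid_of_semigroup.
    * reflexivity.
  + apply (concrete_functor_eq_id
      (functor_comp hom_to_inductive inductive_to_hom)
      (fun A => eq_refl)).
    * exact groupoid_of_semigroup_of_groupoid.
    * reflexivity.
Qed.
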